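(* Let $(P,s,v)$ be a weakly signed differential poset. Then for every $n\ge 2$, $$\sum_{x\in P_n} v(x)\,e(x)^2=0 .$$
   Context: $K$ is a field of characteristic $0$. $P=\bigcup_{n\ge 0}P_n$ is a graded poset ($P_n$ is the set of elements of rank $n$) with finitely many elements of each rank and with a minimum $\hat 0\in P_0$; $x\lessdot y$ means $y$ covers $x$. $\hat KP$ is the $K$-vector space of arbitrary (possibly infinite) $K$-linear combinations of elements of $P$. A linear map $\hat KP\to\hat KP$ is continuous if it preserves infinite linear combinations. A signing of $P$ is a pair $(s,v)$ where $s$ assigns a sign $s(x\lessdot y)\in\{\pm1\}$ to every cover relation of $P$ and $v:P\to\{\pm1\}$; the triple $(P,s,v)$ is called a signed poset. Define continuous linear operators $U,D:\hat KP\to\hat KP$ by $$Ux=\sum_{y:\,x\lessdot y}s(x\lessdot y)\,y,\qquad Dx=\sum_{y:\,y\lessdot x}s(y\lessdot x)\,v(x)\,v(y)\,y\qquad(x\in P).$$ $(P,s,v)$ is weakly signed differential if $v(\hat 0)=1$ and $UD+DU=I$ (the identity). For $x\in P_r$, the signed sum of chains is $e(x)=\sum s(\hat 0\lessdot x_1)s(x_1\lessdot x_2)\cdots s(x_{r-1}\lessdot x_r)$, the sum being over all maximal chains $\hat 0\lessdot x_1\lessdot\cdots\lessdot x_r=x$ from $\hat 0$ to $x$ (so $e(\hat 0)=1$). *)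

(* Defs.v *)
From HB Require Import structures.
From mathcomp Require Import all_boot all_order all_algebra.
From mathcomp Require Import mathcomp_extra boolp classical_sets functions.
From mathcomp Require Import cardinality fsbigop.

Set Implicit Arguments.
Unset Strict Implicit.
Unset Printing Implicit Defensive.

Import Order.TTheory GRing.Theory Num.Theory.
Local Open Scope classical_set_scope.
Local Open Scope ring_scope.

Definition covers (d : Order.disp_t) (P : porderType d) (x y : P) : bool :=
  (x < y)%O && `[< forall z : P, ~ ((x < z)%O /\ (z < y)%O) >].

(* P is graded with rank function rk, has finite levels P_n = rk @^-1` [set n],
   and its minimum has rank 0. *)
Record graded_poset (d : Order.disp_t) (P : bPOrderType d) (rk : P -> nat) :
    Prop := GradedPoset {
  rk_bot : rk \bot%O = 0%N;
  rk_lt : forall x y : P, (x < y)%O -> (rk x < rk y)%N;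
  rk_covers : forall x y : P, covers x y -> rk y = (rk x).+1;
  finite_level : forall n : nat, finite_set [set x : P | rk x = n] }.

(* The values of s at pairs that are not cover relations are irrelevant. *)
Record signing (d : Order.disp_t) (P : porderType d)
    (s : P -> P -> int) (v : P -> int) : Prop := Signing {
  sign_covers : forall x y : P, covers x y -> s x y = 1 \/ s x y = -1;
  sign_elt : forall x : P, v x = 1 \/ v x = -1 }.

(* A vector f : P -> K stands for the infinite linear combination
   \sum_x f x . x; the basis vector of x is the Kronecker delta at x. *)
Definition basis_vec (d : Order.disp_t) (P : porderType d) (K : fieldType)
    (x : P) : P -> K := fun y => (x == y)%:R.

(* The continuous linear extension of a map F from P to vectors, i.e.
   \sum_x f x . x |-> \sum_x f x . F x. It is meaningful when every coefficient
   F x y is nonzero for only finitely many x, which holds for both uses below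
   when P is graded with finite levels (a finitely supported sum \sum_(x \in A)
   is 0 by convention otherwise). *)
Definition cont_ext (d : Order.disp_t) (P : porderType d) (K : fieldType)
    (F : P -> P -> K) (f : P -> K) : P -> K :=
  fun y => \sum_(x \in [set: P]) f x * F x y.

Lemma cont_ext_basis (d : Order.disp_t) (P : porderType d) (K : fieldType)
    (F : P -> P -> K) (x : P) : cont_ext F (basis_vec K x) = F x.
Proof.
apply/funext => y; rewrite /cont_ext /basis_vec.
rewrite -(fsbig_widen [set x] setT) ?fsbig_set1 ?eqxx ?mul1r //.
move=> z [_ /= /eqP zx]; rewrite eq_sym.
by move/negbTE: zx => ->; rewrite mul0r.
Qed.

Definition up_elt (d : Order.disp_t) (P : porderType d) (K : fieldType)
    (s : P -> P -> int) (x : P) : P -> K :=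
  fun y => if covers x y then (s x y)%:~R else 0.

Definition down_elt (d : Order.disp_t) (P : porderType d) (K : fieldType)
    (s : P -> P -> int) (v : P -> int) (x : P) : P -> K :=
  fun y => if covers y x then (s y x * v x * v y)%:~R else 0.

Definition up_op (d : Order.disp_t) (P : porderType d) (K : fieldType)
    (s : P -> P -> int) : (P -> K) -> (P -> K) := cont_ext (up_elt K s).

Definition down_op (d : Order.disp_t) (P : porderType d) (K : fieldType)
    (s : P -> P -> int) (v : P -> int) : (P -> K) -> (P -> K) :=
  cont_ext (down_elt K s v).

Definition weakly_signed_differential (d : Order.disp_t) (P : bPOrderType d)
    (K : fieldType) (s : P -> P -> int) (v : P -> int) : Prop :=
  v \bot%O = 1 /\
  forall f : P -> K,
    up_op s (down_op s v f) + down_op s v (up_op s f) = f.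

(* A maximal chain \bot <. x_1 <. ... <. x_r = x is encoded as the sequence
   [:: x_1; ...; x_r]; for x = \bot it is empty. *)
Definition max_chains (d : Order.disp_t) (P : bPOrderType d) (x : P) :
    set (seq P) :=
  [set c | path (@covers d P) \bot%O c /\ last \bot%O c = x].

Definition chain_sign (d : Order.disp_t) (P : bPOrderType d)
    (s : P -> P -> int) (c : seq P) : int :=
  \prod_(t <- pairmap s \bot%O c) t.

Definition signed_chain_sum (d : Order.disp_t) (P : bPOrderType d)
    (s : P -> P -> int) (x : P) : int :=
  \sum_(c \in max_chains x) chain_sign s c.

(* Main.v *)
Require Import Defs.
From HB Require Import structures.
From mathcomp Require Import all_boot all_order all_algebra.
From mathcomp Require Import mathcomp_extra boolp classical_sets functions.
From mathcomp Require Import cardinality fsbigop.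
From mathcomp Require Import ring.

Set Implicit Arguments.
Unset Strict Implicit.

Import Order.TTheory GRing.Theory Num.Theory.
Local Open Scope classical_set_scope.
Local Open Scope ring_scope.

(** The idea is to pair vectors with the symmetric bilinear form
    <f, g> = \sum_x v x * f x * g x, for which the signs in the definition of D
    are exactly those that make D adjoint to U ([up_down_adjoint]).

    Let w_n = \sum_(rk x = n) e(x) x. Peeling off the last step of each chain
    gives U w_n = w_(n+1) ([up_chain_vec]), so that w_n is U^n(\bot); hence the
    sum to be computed is q_n = <w_n, w_n> = <w_(n-1), D w_n> for n > 0.

    The relation D U = I - U D determines D w_n recursively from D w_0 = 0:
    D w_1 = w_0, then D w_2 = w_1 - U w_0 = 0, and so on with period 2, so that
    D w_n is w_(n-1) for n odd and 0 for n even ([down_chain_vec]). Therefore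
    q_n = 0 for n even, and q_n = q_(n-1) for n odd; as soon as n >= 2, the
    second case falls back on the first one with n - 1 > 0 even. This takes
    place in K, and characteristic 0 brings the result back to the integers. *)

(** * Finitely supported sums *)

Lemma fsumr_intr (R : nzRingType) (I : choiceType) (A : set I)
    (F : I -> int) :
  finite_set A ->
  (\sum_(i \in A) F i)%:~R = \sum_(i \in A) ((F i)%:~R : R).
Proof. by move=> finA; rewrite !fsbig_finite// rmorph_sum. Qed.

Lemma fsumr_delta (V : nmodType) (I : choiceType) (A : set I) (i : I)
    (F : I -> V) :
  A i -> \sum_(j \in A) (if i == j then F j else 0) = F i.
Proof.
move=> Ai; rewrite -(fsbig_widen [set i]) ?fsbig_set1 ?eqxx//.
  by move=> _ ->.
by move=> j [_ /= /eqP ji]; rewrite eq_sym (negbTE ji).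
Qed.

Lemma pchar0_intr_eq0 (K : fieldType) (m : int) :
  [pchar K] =i pred0 -> (m%:~R == 0 :> K) = (m == 0).
Proof.
move/pcharf0P => natK; case: m => m; first by rewrite -pmulrn natK.
by rewrite NegzE rmorphN /= !oppr_eq0 -pmulrn natK.
Qed.

(** * Saturated chains from the minimum *)

Section SaturatedChains.

Variables (d : Order.disp_t) (P : bPOrderType d) (rk : P -> nat).
Hypothesis Pgraded : graded_poset rk.
Variable s : P -> P -> int.

(** All chains of a given length, whatever their end: a finite set independent
    of the end point, so that a sum over it can be exchanged with a sum over
    the elements of a rank. *)
Definition saturated (n : nat) : set (seq P) :=
  [set c | path (@covers d P) \bot%O c /\ size c = n].

Lemma rk_last_saturated (n : nat) (c : seq P) :
  saturated n c -> rk (last \bot%O c) = n.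
Proof.
move=> [+ <-]; elim/last_ind: c => [|c x IHc] /=; first by rewrite rk_bot.
rewrite rcons_path last_rcons size_rcons => /andP[/IHc <-].
exact: rk_covers.
Qed.

Lemma finite_saturated (n : nat) : finite_set (saturated n).
Proof.
elim: n => [|n IHn].
  apply: (sub_finite_set _ (finite_set1 [::])) => c [_ /size0nil ->] //.
have finU := finite_image2 (fun c (x : P) => rcons c x) IHn
  (finite_level Pgraded n.+1).
apply: sub_finite_set finU => c; elim/last_ind: c => [[]//|c x _] satcx.
have rkx := rk_last_saturated satcx; rewrite last_rcons in rkx.
move: satcx => [/=]; rewrite rcons_path size_rcons => /andP[pc _] [szc].
by exists c => //; exists x.
Qed.

Lemma max_chainsE (x : P) :
  max_chains x = saturated (rk x) `&` [set c | last \bot%O c = x].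
Proof.
apply/seteqP; split => c; last by move=> [[]].
move=> [pc lc]; split=> //; split=> //.
by rewrite -lc; apply/esym/rk_last_saturated.
Qed.

Lemma signed_chain_sumE (n : nat) (x : P) : rk x = n ->
  signed_chain_sum s x =
  \sum_(c \in saturated n) (if last \bot%O c == x then chain_sign s c else 0).
Proof.
move=> <-; rewrite /signed_chain_sum max_chainsE fsbig_mkcondr.
apply: eq_fsbigr => c _; congr (if _ then _ else _).
by apply/idP/eqP; rewrite inE.
Qed.

Lemma chain_sign_rcons (c : seq P) (y : P) :
  chain_sign s (rcons c y) = chain_sign s c * s (last \bot%O c) y.
Proof.
by rewrite /chain_sign -cats1 pairmap_cat big_cat /= big_seq1.
Qed.

(** This is the bijection behind the recursion for e: as y has positive rank,
    a chain ending at y is not empty and its last step can be removed. *)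
Lemma max_chains_rcons_bij (n : nat) (y : P) : rk y = n.+1 ->
  set_bij (saturated n `&` [set c | covers (last \bot%O c) y])
    (max_chains y) (fun c => rcons c y).
Proof.
move=> rky; split.
- by move=> c [[pc _] cy]; split; rewrite ?last_rcons// rcons_path pc.
- by move=> c c' _ _ /rcons_inj[].
move=> c; rewrite max_chainsE rky => -[].
elim/last_ind: c => [[]//|c x _] [].
rewrite rcons_path size_rcons /= last_rcons => /andP[pc cx] [szc] xy.
by subst x; exists c.
Qed.

(** Both sides are a sum over the chains of length n that y can extend; on the
    right these chains are sorted by the element x where they end. *)
Lemma signed_chain_sum_rec (n : nat) (y : P) : rk y = n.+1 ->
  signed_chain_sum s y =
  \sum_(x \in [set x : P | rk x = n])
     (if covers x y then signed_chain_sum s x * s x y else 0).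
Proof.
move=> rky; rewrite {1}/signed_chain_sum.
rewrite (reindex_fsbig _ _ _ _ (max_chains_rcons_bij rky)) fsbig_mkcondr.
transitivity (\sum_(c \in saturated n) \sum_(x \in [set x : P | rk x = n])
   (if last \bot%O c == x then
      (if covers x y then chain_sign s c * s x y else 0) else 0)).
  apply: eq_fsbigr => c; rewrite inE => satc.
  rewrite fsumr_delta; last exact: (rk_last_saturated satc).
  rewrite chain_sign_rcons; congr (if _ then _ else _).
  by apply/idP/idP; rewrite inE.
rewrite exchange_fsbig; [|exact: finite_saturated|exact: finite_level].
apply: eq_fsbigr => x; rewrite inE => rkx.
case: ifP => _; last by apply: fsbig1 => c _; case: ifP.
rewrite (signed_chain_sumE rkx) mulr_fsuml.
by apply: eq_fsbigr => c _; case: ifP => //; rewrite mul0r.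
Qed.

End SaturatedChains.

(** * The up and down operators on homogeneous vectors *)

Section UpDown.

Variables (K : fieldType) (d : Order.disp_t) (P : bPOrderType d).
Variables (rk : P -> nat) (s : P -> P -> int) (v : P -> int).
Hypothesis Pgraded : graded_poset rk.

Lemma cont_ext_level (F : P -> P -> K) (n : nat) (f : P -> K) (y : P) :
  (forall x, rk x != n -> f x = 0) ->
  cont_ext F f y = \sum_(x \in [set x : P | rk x = n]) f x * F x y.
Proof.
move=> f0; rewrite /cont_ext; apply/esym/fsbig_widen => // x [_ /= /eqP nx].
by rewrite f0// mul0r.
Qed.

Lemma cont_ext0 (F : P -> P -> K) : cont_ext F 0 = 0.
Proof. by apply/funext => y; apply: fsbig1 => x _; rewrite mul0r. Qed.

(** The factor v x * v y in D turns the v-weight of the upper element into that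
    of the lower one, because v x ^+ 2 = 1. *)
Lemma up_down_adjoint (Psigned : signing s v) (n : nat) (f g : P -> K) :
  (forall x, rk x != n -> f x = 0) -> (forall x, rk x != n.+1 -> g x = 0) ->
  \sum_(y \in [set y : P | rk y = n.+1]) (v y)%:~R * up_op s f y * g y =
  \sum_(x \in [set x : P | rk x = n]) (v x)%:~R * f x * down_op s v g x.
Proof.
move=> f0 g0.
under eq_fsbigr do rewrite /up_op (cont_ext_level _ _ f0) mulr_fsumr mulr_fsuml.
under [RHS]eq_fsbigr do rewrite /down_op (cont_ext_level _ _ g0) mulr_fsumr.
rewrite exchange_fsbig; [|exact: finite_level..].
apply: eq_fsbigr => x _; apply: eq_fsbigr => y _; rewrite /up_elt /down_elt.
case: ifP => _; last by rewrite !mulr0 mul0r.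
have vx2 : (v x)%:~R * (v x)%:~R = 1 :> K.
  by rewrite -intrM; case: (sign_elt Psigned x) => ->.
rewrite !intrM -[LHS]mulr1 -[X in _ * X = _]vx2; ring.
Qed.

Definition chain_vec (n : nat) : P -> K :=
  fun x => if rk x == n then (signed_chain_sum s x)%:~R else 0.

Lemma chain_vec_level (n : nat) (x : P) : rk x != n -> chain_vec n x = 0.
Proof. by rewrite /chain_vec => /negbTE ->. Qed.

Lemma up_chain_vec (n : nat) : up_op s (chain_vec n) = chain_vec n.+1.
Proof.
apply/funext => y; rewrite /up_op (cont_ext_level _ _ (@chain_vec_level n)).
rewrite [RHS]/chain_vec /up_elt; case: eqP => [rky|rky].
  rewrite (signed_chain_sum_rec Pgraded s rky).
  rewrite fsumr_intr; last exact: finite_level.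
  apply: eq_fsbigr => x; rewrite inE /= /chain_vec => ->; rewrite eqxx.
  by case: ifP; rewrite ?mulr0 // intrM.
apply: fsbig1 => x /= rkx; case: ifP => [xy|]; last by rewrite mulr0.
by case: rky; rewrite (rk_covers Pgraded xy) rkx.
Qed.

(** An element of rank 0 covers nothing. *)
Lemma down_chain_vec0 : down_op s v (chain_vec 0) = 0.
Proof.
apply/funext => y; rewrite /down_op (cont_ext_level _ _ (@chain_vec_level 0)).
apply: fsbig1 => x /= rkx; rewrite /down_elt.
case: ifP => [yx|]; last by rewrite mulr0.
by have := rk_covers Pgraded yx; rewrite rkx.
Qed.

Hypothesis Pwsd : weakly_signed_differential K s v.

Lemma down_up (f : P -> K) :
  down_op s v (up_op s f) = f - up_op s (down_op s v f).
Proof. by rewrite -[X in X - _](Pwsd.2 f) addrC addKr. Qed.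

(** If D w_n = 0 then D w_(n+1) = w_n - U D w_n = w_n, and in turn
    D w_(n+2) = w_(n+1) - U w_n = 0. *)
Lemma down_chain_vec (n : nat) :
  down_op s v (chain_vec n.+1) = if odd n then 0 else chain_vec n.
Proof.
elim: n => [|n IHn]; rewrite -up_chain_vec down_up.
  by rewrite down_chain_vec0 [up_op s 0]cont_ext0 subr0.
rewrite IHn /=; case: (odd n) => /=; first by rewrite [up_op s 0]cont_ext0 subr0.
by rewrite up_chain_vec subrr.
Qed.

(** The square <w_n, w_n> for the signed form, not a positive quantity. *)
Definition chain_norm (n : nat) : K :=
  \sum_(x \in [set x : P | rk x = n]) (v x)%:~R * chain_vec n x * chain_vec n x.

(** One of the two factors w_(n+1) = U w_n is moved across as D. *)
Lemma chain_norm_rec (Psigned : signing s v) (n : nat) :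
  chain_norm n.+1 = if odd n then 0 else chain_norm n.
Proof.
rewrite /chain_norm; under eq_fsbigr do rewrite -{1}up_chain_vec.
rewrite (up_down_adjoint Psigned (@chain_vec_level n) (@chain_vec_level n.+1)).
rewrite down_chain_vec; case: (odd n) => //.
by apply: fsbig1 => x _; rewrite mulr0.
Qed.

Lemma chain_norm_eq0 (Psigned : signing s v) (n : nat) : chain_norm n.+2 = 0.
Proof.
by rewrite !(chain_norm_rec Psigned) /=; case: (odd n).
Qed.

End UpDown.

(** * The signed sum of squares *)

Unset Implicit Arguments.
Set Strict Implicit.

Theorem theorem3p2 (K : fieldType) (charK0 : [pchar K] =i pred0)
    (d : Order.disp_t) (P : bPOrderType d) (rk : P -> nat)
    (s : P -> P -> int) (v : P -> int)
    (Pgraded : graded_poset rk) (Psigned : signing s v)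
    (Pwsd : weakly_signed_differential K s v)
    (n : nat) (n_ge2 : (2 <= n)%N) :
  \sum_(x \in [set x : P | rk x = n]) v x * signed_chain_sum s x ^+ 2 = 0.
Proof.
apply/eqP; rewrite -(pchar0_intr_eq0 _ charK0); apply/eqP.
case: n n_ge2 => [|[|n]] // _.
rewrite -[RHS](chain_norm_eq0 Pgraded Pwsd Psigned n).
rewrite fsumr_intr; last exact: finite_level.
apply: eq_fsbigr => x; rewrite inE /= /chain_vec => ->.
by rewrite eqxx -mulrA !intrM.
Qed.
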